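(* Let $F$ be a field, $n\geq 2$, and let $P$ be a standard parabolic subgroup of $G=\mathrm{GL}_n(F)$ with Weyl group $W$. Let $O_1,\dots,O_r$ be the orbits of $W$ acting on $\{1,\dots,n\}$. Let $C$ and $D$ be $n\times n$ matrices over $F$ and let $Y$ and $Z$ be sub-permutation $(0,1)$-matrices that are $B$-equivalent to $C$ and $D$, respectively. Then the following conditions are equivalent: (a) $C$ and $D$ are $P$-equivalent. (b) $C[i,j]=D[i,j]$ for all $1\leq i,j\leq r$. (c) $Y$ and $Z$ are $W$-equivalent. (d) $Y\{i,j\}=Z\{i,j\}$ for all $1\leq i,j\leq r$.
   Context: $X'$ denotes the transpose of $X$. $B$ is the group of all invertible upper triangular $n\times n$ matrices over $F$. For a subgroup $H$ of $G$, $n\times n$ matrices $X,Y$ over $F$ are $H$-equivalent if there exist $h,k\in H$ such that $Y=h'Xk$. A standard parabolic subgroup $P$ of $G$ is a subgroup containing $B$. Such a $P$ is generated by $B$ and a set $J$ of transpositions of the form $(i,i+1)$, $1\le i<n$, viewed as permutation matrices (equivalently, $P$ is the group of invertible block upper triangular matrices for some fixed decomposition of $n$ into diagonal block sizes). The Weyl group $W$ of $P$ is the subgroup of $S_n$ generated by $J$; it is also viewed as a subgroup of $G$ via permutation matrices. $M_i$ denotes the largest index in the orbit $O_i$. A $(0,1)$-matrix is a matrix whose entries are all $0$ or $1$. A sub-permutation is a matrix having at most one non-zero entry in every row and every column. If $Y$ is an $n\times n$ sub-permutation $(0,1)$-matrix, a $Y$-couple is a pair $(f,\sigma)$ with $\sigma\in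 S_n$ and $f:\{1,\dots,n\}\to\{0,1\}$ such that $Ye_i=f(i)e_{\sigma(i)}$ for $1\le i\le n$, where $e_1,\dots,e_n$ is the canonical basis of $F^n$; $S(f)$ is the set of indices where $f$ does not vanish. For $1\le i,j\le r$, $Y\{i,j\}$ is the number of indices $k$ such that $k\in S(f)$, $k\in O_i$ and $\sigma(k)\in O_j$ (this does not depend on the choice of the $Y$-couple). For an $n\times n$ matrix $C$ and $1\le i,j\le r$, $C[i,j]$ is the rank of the $M_j\times M_i$ top left submatrix of $C$. *)

(* Defs.v *)
From mathcomp Require Import all_boot all_order all_algebra all_fingroup.
From mathcomp Require Import ring.
From Stdlib Require ClassicalEpsilon.

Set Implicit Arguments.
Unset Strict Implicit.
Unset Printing Implicit Defensive.

Import GRing.Theory.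
Local Open Scope ring_scope.

Section Definitions.
Variables (F : fieldType) (n : nat).
Implicit Types (H P : 'M[F]_n -> Prop) (C X Y : 'M[F]_n).

Definition GL_subgroup H : Prop :=
  [/\ forall g, H g -> g \in unitmx,
      H 1%:M,
      forall g h, H g -> H h -> H (g *m h)
    & forall g, H g -> H (invmx g)].

Definition GL_generated (S : 'M[F]_n -> Prop) : 'M[F]_n -> Prop :=
  fun g => forall H, GL_subgroup H -> (forall x, S x -> H x) -> H g.

(* [is_trig_mx] means lower triangular. *)
Definition borel : 'M[F]_n -> Prop :=
  fun g => g \in unitmx /\ is_trig_mx g^T.

Definition standard_parabolic P : Prop :=
  GL_subgroup P /\ (forall g, borel g -> P g).

(* [perm_mx s] sends the basis vector e_i to e_(s^-1 i); this is immaterial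
   here, since it is only used for sets of permutations closed under inverse. *)
Definition perm_mxs (A : {set 'S_n}) : 'M[F]_n -> Prop :=
  fun g => exists2 s, s \in A & g = perm_mx s.

Definition adjacent_transpositions : {set 'S_n} :=
  [set s | [exists i : 'I_n, exists j : 'I_n, (j == i.+1 :> nat) && (s == tperm i j)]].

Definition weyl_group P (W : {group 'S_n}) : Prop :=
  exists J : {set 'S_n},
    [/\ J \subset adjacent_transpositions,
        forall g, P g <-> GL_generated (fun x => borel x \/ perm_mxs J x) g
      & W = <<J>>%G].

Definition mx_equiv H X Y : Prop :=
  exists h k, [/\ H h, H k & Y = h^T *m X *m k].

Definition zero_one_mx Y : Prop := forall i j, Y i j = 0 \/ Y i j = 1.

Definition sub_permutation Y : Prop :=
  (forall i j1 j2, Y i j1 != 0 -> Y i j2 != 0 -> j1 = j2) /\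
  (forall j i1 i2, Y i1 j != 0 -> Y i2 j != 0 -> i1 = i2).

Definition basis_vec (i : 'I_n) : 'cV[F]_n := delta_mx i 0.

Definition couple Y (c : {ffun 'I_n -> bool} * 'S_n) : bool :=
  [forall i, Y *m basis_vec i == (c.1 i)%:R *: basis_vec (c.2 i)].

Definition couple_count (O1 O2 : {set 'I_n})
    (c : {ffun 'I_n -> bool} * 'S_n) : nat :=
  #|[set k | [&& c.1 k, k \in O1 & c.2 k \in O2]]|.

(* Y{i,j}, computed from an arbitrary Y-couple: see [couple_exists] and
   [transfer_countE]. *)
Definition transfer_count Y (O1 O2 : {set 'I_n}) : nat :=
  if [pick c | couple Y c] is Some c then couple_count O1 O2 c else 0%N.

Definition weyl_orbits (W : {group 'S_n}) : {set {set 'I_n}} :=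
  orbit 'P W @: [set: 'I_n].

(* The largest index of O, indices being counted from 1. *)
Definition max_index (O : {set 'I_n}) : nat := \max_(k in O) k.+1.

Lemma max_index_le (O : {set 'I_n}) : (max_index O <= n)%N.
Proof. by apply/bigmax_leqP=> k _. Qed.

(* C[i,j]: the second orbit bounds the rows, the first one the columns. *)
Definition corner_rank C (O1 O2 : {set 'I_n}) : nat :=
  \rank (mxsub (widen_ord (max_index_le O2)) (widen_ord (max_index_le O1)) C).

End Definitions.

Section WellDefined.
Variables (F : fieldType) (n : nat).
Implicit Types (P : 'M[F]_n -> Prop) (Y : 'M[F]_n).

Lemma coupleP Y (c : {ffun 'I_n -> bool} * 'S_n) :
  reflect (forall i j, Y j i = (c.1 i && (j == c.2 i))%:R) (couple Y c).
Proof.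
have E i j : (Y *m basis_vec F i) j 0 = Y j i.
  rewrite mxE (bigD1 i) //= big1 ?addr0 => [|k ki]; rewrite mxE ?eqxx ?mulr1 //.
  by rewrite (negPf ki) mulr0.
apply: (iffP forallP) => [Yc i j | Yc i].
  by rewrite -E (eqP (Yc i)) !mxE andbT -natrM mulnb.
by apply/eqP/colP=> j; rewrite E Yc !mxE andbT -natrM mulnb.
Qed.

Lemma couple_exists Y :
  zero_one_mx Y -> sub_permutation Y -> exists c, couple Y c.
Proof.
move=> Y01 [Yrow Ycol].
pose f := [ffun j => [exists i, Y i j != 0]].
pose g j := odflt j [pick i | Y i j != 0].
have gP j : f j -> Y (g j) j != 0.
  rewrite ffunE /g; case: pickP => [//|Y0] /existsP[i].
  by rewrite Y0.
have [E memE uE] : exists2 E : seq 'I_n, forall j, j \in E & uniq E.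
  by exists (enum 'I_n); [move=> j; rewrite mem_enum | apply: enum_uniq].
pose A := [seq j <- E | f j].
pose L1 := A ++ [seq j <- E | ~~ f j].
pose gA := map g A.
pose L2 := gA ++ [seq i <- E | i \notin gA].
have L1mem j : j \in L1.
  by rewrite /L1 /A mem_cat !mem_filter !memE !andbT orbN.
have L2mem i : i \in L2.
  by rewrite /L2 mem_cat mem_filter memE andbT orbN.
have uA : uniq A by rewrite filter_uniq.
have uL1 : uniq L1.
  rewrite cat_uniq uA filter_uniq // andbT.
  by apply/hasPn=> j; rewrite !mem_filter => /andP[/negPf->].
have uL2 : uniq L2.
  rewrite cat_uniq filter_uniq // andbT; apply/andP; split.
    rewrite map_inj_in_uniq // => j1 j2.
    rewrite !mem_filter => /andP[/gP f1 _] /andP[/gP f2 _] e.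
    by apply: (Yrow (g j1)) => //; rewrite e.
  by apply/hasPn=> i; rewrite mem_filter => /andP[].
have sz L : uniq L -> (forall i : 'I_n, i \in L) -> size L = n.
  move=> uL memL; rewrite -[RHS]card_ord -(card_uniqP uL).
  by apply: eq_card => i; rewrite memL.
have sz1 := sz _ uL1 L1mem; have sz2 := sz _ uL2 L2mem.
have ixlt j : (index j L1 < size L2)%N by rewrite sz2 -[X in (_ < X)%N]sz1 index_mem.
pose s j := nth j L2 (index j L1).
have s_inj : injective s.
  move=> j1 j2; rewrite /s (set_nth_default j2) => [e|].
    apply: (index_inj j1 (L1mem j1) (L1mem j2)); apply/eqP.
    by rewrite -(nth_uniq j2 (ixlt j1) (ixlt j2) uL2) e.
  exact: ixlt.
exists (f, perm s_inj); apply/coupleP => j i /=.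
case: (boolP (f j)) => [fj | ].
  have jA : j \in A by rewrite mem_filter fj memE.
  have -> : perm s_inj j = g j.
    rewrite permE /s index_cat jA nth_cat size_map index_mem jA.
    by rewrite (nth_map j) ?nth_index ?index_mem.
  case: eqP => [->|ne].
    by case: (Y01 (g j) j) (gP _ fj) => ->; rewrite ?eqxx.
  by apply/eqP; case: eqP => // /eqP Yij; case: ne; apply: Ycol Yij (gP _ fj).
by rewrite ffunE negb_exists => /forallP/(_ i); rewrite negbK => /eqP.
Qed.

Lemma transfer_countE Y c O1 O2 :
  couple Y c -> transfer_count Y O1 O2 = couple_count O1 O2 c.
Proof.
move=> Yc; rewrite /transfer_count; case: pickP => [d Yd|]; last first.
  by move/(_ c); rewrite Yc.
have key a b k : couple Y a -> couple Y b -> a.1 k -> b.1 k /\ a.2 k = b.2 k.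
  move=> /coupleP Ya /coupleP Yb ak.
  move: (Yb k (a.2 k)); rewrite Ya ak eqxx.
  case: (b.1 k) => /=; last by move/eqP; rewrite oner_eq0.
  by case: eqP => // _ /eqP; rewrite oner_eq0.
apply: eq_card => k; rewrite !inE.
case dk: (d.1 k); first by case: (key _ _ _ Yd Yc dk) => -> ->.
by case ck: (c.1 k) => //; case: (key _ _ _ Yc Yd ck); rewrite dk.
Qed.


Lemma GL_generated_subgroup (S : 'M[F]_n -> Prop) :
  (forall g, S g -> g \in unitmx) -> GL_subgroup (GL_generated S).
Proof.
move=> Su; split=> [g|H [] //|g h Hg Hh H sH SH|g Hg H sH SH].
- move/(_ (fun x => x \in unitmx)); apply=> //; split=> //; first exact: unitmx1.
  + by move=> a b ua ub; rewrite unitmx_mul ua.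
  + by move=> a; rewrite unitmx_inv.
- by case: (sH) => _ _ mH _; apply: mH; [apply: Hg | apply: Hh].
- by case: (sH) => _ _ _ vH; apply: vH; apply: Hg.
Qed.

Lemma borelP (g : 'M[F]_n) :
  (forall k l : 'I_n, (l < k)%N -> g k l = 0) -> (forall k, g k k != 0) -> borel g.
Proof.
move=> gU gD; have gT : is_trig_mx g^T.
  by apply/is_trig_mxP=> k l lt; rewrite mxE gU.
split=> //; rewrite unitmxE -det_tr det_trig // unitfE.
by apply/prodf_neq0 => i _; rewrite mxE.
Qed.

Lemma mulmx_deltaE (M : 'M[F]_n) (a b k l : 'I_n) :
  (M *m delta_mx a b) k l = M k a * (l == b)%:R.
Proof.
rewrite mxE (bigD1 a) //= big1 => [|i ia]; first by rewrite mxE eqxx addr0.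
by rewrite mxE (negPf ia) mulr0.
Qed.

Lemma tperm_factor (p q : 'I_n) (c : F) : p != q -> c != 0 ->
  (1%:M - c^-1 *: delta_mx p q) *m (1%:M + c *: delta_mx q p) *m
  (1%:M - c^-1 *: delta_mx p q) *m
  (1%:M + (c^-1 - 1) *: delta_mx p p + (- c - 1) *: delta_mx q q)
  = perm_mx (tperm p q).
Proof.
move=> npq nc; have nqp : q != p by rewrite eq_sym.
have er (M : 'M[F]_n) a b c' k l :
    (M *m (1%:M + c' *: delta_mx a b)) k l = M k l + c' * (M k a * (l == b)%:R).
  by rewrite mulmxDr mulmx1 -scalemxAr mxE [in X in _ + X]mxE mulmx_deltaE.
have -> : 1%:M - c^-1 *: delta_mx p q = 1%:M + (- c^-1) *: delta_mx p q :> 'M[F]_n.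
  by rewrite scaleNr.
apply/matrixP=> k l; rewrite mulmxDr mxE er -scalemxAr [in X in _ + X]mxE mulmx_deltaE.
rewrite !er !mxE !eqxx (negPf npq) (negPf nqp) /=.
case: tpermP => [->|->|/eqP/negPf kp /eqP/negPf kq].
- rewrite !eqxx (negPf npq) /= !(eq_sym p) !(eq_sym q).
  case: (eqVneq l p) => [->|lp]; rewrite ?(negPf npq) /=; last case: (l == q) => /=; field; exact: nc.
- rewrite !eqxx (negPf nqp) /= !(eq_sym p) !(eq_sym q).
  case: (eqVneq l q) => [->|lq]; rewrite ?(negPf nqp) /=; last case: (l == p) => /=; field; exact: nc.
- rewrite kp kq /=; case: (k == l) => /=; field; exact: nc.
Qed.

(* Every subgroup containing the Borel subgroup has a Weyl group. *)
Lemma weyl_group_exists P : standard_parabolic P -> exists W, weyl_group P W.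
Proof.
case=> sP BP; have [Pu P1 PM PV] := sP.
pose J := [set s in adjacent_transpositions n |
  if ClassicalEpsilon.excluded_middle_informative (P (perm_mx s))
  then true else false].
have JP s : s \in J <-> s \in adjacent_transpositions n /\ P (perm_mx s).
  rewrite inE; case: ClassicalEpsilon.excluded_middle_informative => sPs.
    by rewrite andbT; split=> [|[]].
  by rewrite andbF; split=> // -[].
pose S (x : 'M[F]_n) := borel x \/ perm_mxs J x.
pose Q : 'M[F]_n -> Prop := GL_generated S.
exists <<J>>%G; exists J; split=> //; first by apply/subsetP=> s /JP[].
have SP x : S x -> P x by case=> [/BP //|[s /JP[_ Ps] ->]].
have sQ : GL_subgroup Q by apply: GL_generated_subgroup => g /SP/Pu.
have [Qu Q1 QM QV] := sQ.
have SQ x : S x -> Q x by move=> Sx H _; apply.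
have QP x : Q x -> P x by apply.
move=> h0; split; last exact: QP.
pose up m (h : 'M[F]_n) := forall k l : 'I_n, (l < m)%N -> (l < k)%N -> h k l = 0.
have swap (p a : 'I_n) (c : F) : a = p.+1 :> nat -> c != 0 ->
    P (1%:M + c *: delta_mx a p) -> Q (perm_mx (tperm p a)).
  move=> ap nc PL; apply: SQ; right; exists (tperm p a) => //; apply/JP; split.
    by rewrite inE; apply/existsP; exists p; apply/existsP; exists a; rewrite ap !eqxx.
  have npa : p != a by rewrite -val_eqE /= ap neq_ltn ltnSn.
  have PU : P (1%:M - c^-1 *: delta_mx p a).
    apply: BP; apply: borelP => [k l lk|k]; rewrite !mxE.
      rewrite -val_eqE /= gtn_eqF // (_ : _ && _ = false) ?mulr0 ?subr0 //.
      by apply/negP=> /andP[/eqP e1 /eqP e2]; move: lk; rewrite e1 e2 ap ltnNge leqnSn.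
    rewrite eqxx (_ : _ && _ = false) ?mulr0 ?subr0 ?oner_eq0 //.
    by apply/negP=> /andP[/eqP-> /eqP e]; rewrite e eqxx in npa.
  rewrite -(tperm_factor npa nc); apply: (PM); first by apply: (PM) => //; apply: PM.
  apply: BP; apply: borelP => [k l lk|k]; rewrite !mxE.
    have E (x : 'I_n) : (k == x) && (l == x) = false.
      by apply/negP=> /andP[/eqP e1 /eqP e2]; rewrite e1 e2 ltnn in lk.
    by rewrite !E -val_eqE /= gtn_eqF // !mulr0 !addr0.
  rewrite eqxx !andbb; case: (eqVneq k p) => [->|kp].
    by rewrite (negPf npa) mulr0 addr0 mulr1 addrC subrK invr_eq0.
  case: (k == a); rewrite !(mulr0, mulr1, addr0) ?oner_eq0 //.
  by rewrite addrC subrK oppr_eq0.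
have col (j : 'I_n) m h : P h -> up j h ->
    (forall k : 'I_n, (m < k)%N -> (j < k)%N -> h k j = 0) ->
    exists2 q, Q q & up j.+1 (q *m h).
  elim: m h => [|m IH] h Ph uph hj.
    exists 1%:M => //; rewrite mul1mx => k l; rewrite ltnS leq_eqVlt.
    case/orP=> [/eqP/val_inj-> jk | lj lk]; last exact: uph.
    by apply: hj => //; apply: leq_ltn_trans jk.
  have skip (a : 'I_n) : (forall k : 'I_n, k = m.+1 :> nat -> (j < k)%N -> h k j = 0) ->
      exists2 q, Q q & up j.+1 (q *m h).
    move=> hm; apply: IH => // k; rewrite leq_eqVlt => /orP[/eqP e|].
      exact: hm.
    exact: hj.
  case: (ltnP m.+1 n) => [mn|nm]; last first.
    by apply: skip => // k e; move: (ltn_ord k); rewrite e ltnNge nm.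
  pose a := Ordinal mn; pose p := Ordinal (ltnW mn).
  case: (ltnP j m.+1) => [ja|aj]; last first.
    by apply: skip => // k ->; rewrite ltnNge aj.
  have [h0j|haj] := eqVneq (h a j) 0.
    by apply: skip => // k e _; rewrite -[RHS]h0j; congr (h _ _); apply: val_inj.
  pose v : 'cV[F]_n := \col_k (if (k < a)%N then - (h k j / h a j) else 0).
  pose u : 'M[F]_n := 1%:M + v *m delta_mx 0 a.
  have uE k l : u k l = (k == l)%:R + v k 0 * (l == a)%:R.
    by rewrite !mxE big_ord1 !mxE eqxx /=.
  have Bu : borel u.
    apply: borelP => [k l lk|k]; rewrite uE.
      rewrite -val_eqE /= gtn_eqF // add0r; case: eqP => [e|]; rewrite ?mulr0 //.
      by rewrite mxE -e ltnNge (ltnW lk) mul0r.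
    case: (eqVneq k a) => [->|]; rewrite eqxx ?mulr0 ?addr0 ?oner_eq0 //.
    by rewrite mxE ltnn mul0r addr0 oner_eq0.
  pose h1 := u *m h.
  have h1E k l : h1 k l = h k l + v k 0 * h a l.
    rewrite /h1 /u mulmxDl mul1mx -mulmxA -rowE [LHS]mxE; congr (_ + _).
    by rewrite mxE big_ord1 !mxE.
  have Ph1 : P h1 by apply: (PM) => //; apply: BP.
  have up1 : up j h1.
    move=> k l lj lk; rewrite h1E uph // (uph a) ?mulr0 ?addr0 //.
    by apply: ltn_trans lj _.
  have h1j k : k != a -> h1 k j = 0.
    move=> ka; rewrite h1E mxE; case: ltnP => ak; first by rewrite mulNr divfK ?subrr.
    rewrite mul0r addr0; apply: hj; last by apply: leq_trans ak.
    by rewrite ltn_neqAle ak andbT eq_sym.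
  have h1a : h1 a j = h a j by rewrite h1E mxE ltnn mul0r addr0.
  have apE : a = p.+1 :> nat by [].
  have npa : p != a by rewrite -val_eqE /= neq_ltn ltnSn.
  have Qs : Q (perm_mx (tperm p a)).
    apply: (swap _ _ (h a j)) => //.
    pose X := 1%:M + delta_mx j p *m h1.
    have XE k l : X k l = (k == l)%:R + (k == j)%:R * h1 p l.
      rewrite !mxE (bigD1 p) //= big1 => [|i ip].
        by rewrite !mxE eqxx andbT addr0.
      by rewrite mxE (negPf ip) andbF mul0r.
    have BX : borel X.
      apply: borelP => [k l lk|k]; rewrite XE.
        rewrite -val_eqE /= gtn_eqF // add0r.
        case: eqP => [e|]; rewrite ?mul0r //; have lj : (l < j)%N by rewrite -e.
        by rewrite up1 ?mulr0 //; apply: leq_trans lj _.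
      case: (eqVneq k j) => [->|_]; rewrite eqxx ?mul0r ?addr0 ?oner_eq0 //.
      by rewrite h1j // mulr0 addr0 oner_eq0.
    have -> : 1%:M + h a j *: delta_mx a p = h1 *m X *m invmx h1.
      rewrite /X mulmxDr mulmx1 mulmxDl mulmxV ?Pu //; congr (_ + _).
      rewrite (mulmxA h1) mulmxK ?Pu //.
      apply/matrixP=> k l; rewrite mulmx_deltaE 2!mxE.
      case: (eqVneq k a) => [->|ka]; first by rewrite h1a.
      by rewrite h1j // mulr0 mul0r.
    by apply: (PM); [apply: (PM) => //; apply: BP | apply: PV].
  pose h2 := perm_mx (tperm p a) *m h1.
  have h2E k l : h2 k l = h1 (tperm p a k) l by rewrite /h2 -row_permE mxE.
  have up2 : up j h2.
    move=> k l lj lk; rewrite h2E; apply: (up1) => //.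
    case: tpermP => // _; first by apply: ltn_trans lj _.
    by apply: leq_trans lj _.
  have [||q Qq upq] := IH h2 _ up2; first by apply: (PM) => //; apply: QP.
    move=> k mk _; rewrite h2E; apply: h1j.
    apply/negP=> /eqP e; move: mk; rewrite (_ : k = p) ?ltnn //.
    by apply: (@perm_inj _ (tperm p a)); rewrite e tpermL.
  exists (q *m perm_mx (tperm p a) *m u).
    by apply: (QM); [apply: QM | apply: SQ; left].
  by rewrite -!mulmxA.
move=> Ph.
have [q Qq upq] : exists2 q, Q q & up n (q *m h0).
  have : forall m, (m <= n)%N -> exists2 q, Q q & up m (q *m h0).
    elim=> [_|m IH mn]; first by exists 1%:M.
    have [q Qq upq] := IH (ltnW mn).
    have [||r Qr upr] := col (Ordinal mn) n (q *m h0) _ upq.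
    - by apply: (PM) => //; apply: QP.
    - by move=> k; rewrite ltnNge ltnW.
    by exists (r *m q); [apply: QM | rewrite -mulmxA].
  exact.
have uq : q \in unitmx by apply: Qu.
have -> : h0 = invmx q *m (q *m h0) by rewrite mulKmx.
apply: (QM); first exact: QV.
apply: SQ; left; split; first by rewrite unitmx_mul uq Pu.
by apply/is_trig_mxP=> k l kl; rewrite mxE upq.
Qed.

End WellDefined.

(* Main.v *)
Require Import Defs.
From mathcomp Require Import all_boot all_order all_algebra all_fingroup.
From mathcomp Require Import zify.

Set Implicit Arguments.
Unset Strict Implicit.
Unset Printing Implicit Defensive.

Import GRing.Theory.
Local Open Scope ring_scope.

(* The conditions are linked as (a) -> (b) -> (d) -> (c) -> (a). An element of P
   preserves the flag cut at the maxima of the W-orbits, so the ranks of the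
   corresponding corners are invariant under P-equivalence. As Y is B-equivalent
   to C, these ranks count the nonzero entries of Y in the corners; the orbits
   being the intervals between consecutive maxima, inclusion-exclusion gives the
   numbers Y{i,j}. If Y{i,j} = Z{i,j}, a permutation of the columns preserving
   the orbits makes the orbits of the images of e_k under Y and Z agree for all
   k, then one of the rows makes the images themselves agree; both lie in W,
   which contains every permutation preserving its orbits. *)

(** * Rearranging indices so that their labels match *)

(** In a finite group inverses are powers, so every element of [<<A>>] is a product of elements of
    [A] and the induction has no inverse case. *)
Lemma generated_ind (gT : finGroupType) (A : {set gT}) (Q : gT -> Prop) :
  Q 1%g -> (forall x y, x \in A -> Q y -> Q (x * y)%g) ->
  forall w, w \in <<A>>%g -> Q w.
Proof.
move=> Q1 QM w /gen_prodgP[m [c cA ->]].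
by elim/big_rec: _ => // i x _; apply: QM.
Qed.

(** The value lists of [p] and [q] have equal multiplicities, so one rearranges the other; [s] is
    the permutation of positions. *)
Lemma perm_of_card_fibres (n : nat) (L : eqType) (p q : 'I_n -> L) :
  (forall v, #|[set t | p t == v]| = #|[set t | q t == v]|) ->
  exists s : 'S_n, forall t, q (s t) = p t.
Proof.
move=> pq; pose tp (f : 'I_n -> L) := [tuple of [seq f i | i <- ord_tuple n]].
have count_tp f v : count_mem v (tp f) = #|[set t | f t == v]|.
  rewrite count_map /= cardE {2}/enum_mem size_filter -enumT.
  by apply: eq_count => t; rewrite !inE.
have /tuple_permP[s s_eq] : perm_eq (tp p) (tp q).
  by apply/allP => v _ /=; rewrite !count_tp pq.
exists s => t; have := congr1 (fun u => nth (p t) u t) s_eq.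
rewrite /= (nth_map t) ?size_enum_ord // nth_ord_enum => ->.
by rewrite (nth_map t) ?size_enum_ord // nth_ord_enum tnth_map tnth_ord_tuple.
Qed.

(* The fibres over [None] are the complements of the others in the fibres of [o]. *)
Lemma perm_of_partial_fibres (n : nat) (L : eqType) (K : finType)
    (o : 'I_n -> L) (h1 h2 : 'I_n -> option K) :
  (forall l k, #|[set t | (o t == l) && (h1 t == Some k)]|
             = #|[set t | (o t == l) && (h2 t == Some k)]|) ->
  exists s : 'S_n, forall t, o (s t) = o t /\ h2 (s t) = h1 t.
Proof.
move=> eq_h.
have [[l [k|]]|s sE] :=
    @perm_of_card_fibres n _ (fun t => (o t, h1 t)) (fun t => (o t, h2 t)).
- exact: eq_h.
- have split_card (h : 'I_n -> option K) : #|[set t | (o t, h t) == (l, None)]| =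
      (#|[set t | o t == l]| - \sum_k #|[set t | (o t == l) && (h t == Some k)]|)%N.
    have -> : #|[set t | o t == l]| = (#|[set t | (o t, h t) == (l, None)]| +
        \sum_k #|[set t | (o t == l) && (h t == Some k)]|)%N; last by rewrite addnK.
    transitivity (\sum_(u : option K) \sum_(t | (o t == l) && (h t == u)) 1)%N.
      rewrite -(@partition_big _ _ _ _ _ _ (fun t => o t == l) h xpredT) //.
      by rewrite sum1_card cardsE.
    have cE u : (\sum_(t | (o t == l) && (h t == u)) 1)%N
        = #|[set t | (o t == l) && (h t == u)]|.
      by rewrite sum1_card cardsE.
    rewrite (bigD1 None) //= cE; congr (_ + _)%N.
    under eq_bigr do rewrite cE.
    rewrite (reindex_omap Some id) /=; last by case.
    by apply: eq_bigl => k; rewrite eqxx.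
  by rewrite !split_card; congr (_ - _)%N; apply: eq_bigr => k _; apply: eq_h.
- by exists s => t; have [] := sE t.
Qed.

(** * Subgroups generated by adjacent transpositions, and their orbits *)

Section WeylGroup.
Variables (n : nat) (J : {set 'S_n}).
Hypothesis J_adj : J \subset adjacent_transpositions n.
Let W : {group 'S_n} := <<J>>%G.

Lemma mem_adjacent s : s \in J -> exists2 i : 'I_n * 'I_n,
  i.2 = i.1.+1 :> nat & s = tperm i.1 i.2.
Proof.
move/(subsetP J_adj); rewrite inE => /existsP[i /existsP[j /andP[/eqP e /eqP ->]]].
by exists (i, j).
Qed.

(** Induction on a word carrying [x] to [y]: after a first letter [s], [tperm x y] is the conjugate
    of [tperm (s x) y] by [tperm x (s x)], unless some of these points coincide. *)
Lemma tperm_orbit x y : y \in orbit 'P W x -> tperm x y \in W.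
Proof.
case/orbitP=> w wW <-; move: w wW x.
apply: generated_ind => [|s w sJ IH] x.
  by rewrite /= /aperm perm1 tperm1 group1.
have sW : s \in W by apply: mem_gen.
rewrite /= /aperm permM.
have tW : tperm x (s x) \in W.
  have [[i j] /= _ es] := mem_adjacent sJ.
  case: (eqVneq (s x) x) => [->|sx]; first by rewrite tperm1 group1.
  move: sx sW; rewrite es; case: tpermP => [->|->|]; rewrite ?eqxx //.
  by rewrite tpermC.
have := IH (s x); rewrite /= /aperm => wt.
case: (eqVneq (s x) x) => [e|sx]; first by move: wt; rewrite e.
case: (eqVneq (w (s x)) x) => [->|wx]; first by rewrite tperm1 group1.
case: (eqVneq (w (s x)) (s x)) => [->//|wsx].
have -> : tperm x (w (s x)) = (tperm (s x) (w (s x)) ^ tperm x (s x))%g.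
  by rewrite tpermJ tpermR tpermD // eq_sym.
by rewrite groupJ.
Qed.

(* A parabolic subgroup of the symmetric group is a full Young subgroup. *)
Lemma mem_weyl_orbit (s : 'S_n) : (forall x, orbit 'P W (s x) = orbit 'P W x) -> s \in W.
Proof.
move: {2}_.+1 (ltnSn #|[set x | s x != x]|) => m.
elim: m s => // m IH s; rewrite ltnS => sm s_orb.
have [/forallP s1|] := boolP [forall x, s x == x].
  suff -> : s = 1%g by apply: group1.
  by apply/permP=> x; rewrite perm1; apply/eqP.
rewrite negb_forall => /existsP[x sx].
have tW : tperm x (s x) \in W by apply: tperm_orbit; apply/orbit_eqP.
(* The product [s * tperm x (s x)] fixes [x] and all fixed points of [s], so it moves fewer
   points. *)
rewrite -(groupMr _ tW); apply: IH => [|y].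
  apply: leq_trans sm; apply: proper_card; apply/properP; split.
    apply/subsetP=> y; rewrite !inE permM; apply: contraNneq => sy.
    rewrite sy; case: tpermP => [e|e|//]; first by rewrite -{1}e sy.
    by rewrite -(inj_eq (@perm_inj _ s)) sy -e.
  by exists x; rewrite inE ?permM ?tpermR ?eqxx.
rewrite permM -(s_orb y); case: tpermP => [->|->|//].
  exact: s_orb.
exact/esym/s_orb.
Qed.

(** A generator swaps neighbours [i] and [i+1] of a single orbit, so [i] cannot be the last element
    of [O], the only case in which the segment would be broken. *)
Lemma weyl_initial_segment (O : {set 'I_n}) (w : 'S_n) k : O \in weyl_orbits W ->
  w \in W -> (w k < max_index O)%N = (k < max_index O)%N.
Proof.
case/imsetP=> x _ OE wW; move: w wW k.
apply: generated_ind => [|s w sJ IH] k; first by rewrite perm1.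
rewrite permM IH {w IH}.
have sW : s \in W by apply: mem_gen.
have xO : x \in O by rewrite OE orbit_refl.
have [[i j] /= ij es] := mem_adjacent sJ.
suff lt_ij : (i < max_index O)%N = (j < max_index O)%N.
  by rewrite es; case: tpermP => [->|->|].
apply/idP/idP => [iM|]; last by rewrite ij; apply: ltnW.
(* Ordinals start at 0 but [max_index] counts from 1, so [eM] says that [i] is the last element of
   [O]. *)
rewrite ltn_neqAle ij iM andbT; apply/eqP => eM.
have [|y yO yM] := eq_bigmax_cond (fun k : 'I_n => k.+1) (A := mem O).
  by apply/card_gt0P; exists x.
have eyi : y = i by apply: val_inj; move: yM; rewrite -/(max_index O) -eM => -[].
have jO : j \in O.
  rewrite OE; apply/orbit_eqP.
  have <- : orbit 'P W i = orbit 'P W x by apply/orbit_eqP; rewrite -OE -eyi.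
  by apply/orbit_eqP; apply/orbitP; exists s => //; rewrite /= /aperm es tpermL.
have := leq_bigmax_cond (F := fun k : 'I_n => k.+1) _ jO.
by rewrite -/(max_index O) -eM ij ltnn.
Qed.

(** Here [lo] is the largest [max_index] among the orbits ending before [O], or 0 if there is none.
    Both ends of the interval are thus 0 or corner sizes, as inclusion-exclusion requires. *)
Lemma weyl_orbit_interval (O : {set 'I_n}) : O \in weyl_orbits W ->
  exists lo, [/\ lo = 0%N \/ exists2 O', O' \in weyl_orbits W & lo = max_index O',
     (lo <= max_index O)%N
   & forall k, (k \in O) = (lo <= k < max_index O)%N].
Proof.
move=> OW; pose lo :=
  (\max_(O' in [set O' in weyl_orbits W | max_index O' < max_index O]) max_index O')%N.
have max_mem O' : O' \in weyl_orbits W -> exists2 y, y \in O' & max_index O' = y.+1.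
  case/imsetP=> x _ ->.
  have [|y yO yM] := eq_bigmax_cond (fun k : 'I_n => k.+1) (A := mem (orbit 'P W x)).
    by apply/card_gt0P; exists x; apply: orbit_refl.
  by exists y.
have orb_lt O' k w : O' \in weyl_orbits W -> w \in orbit 'P W k ->
    (w < max_index O')%N = (k < max_index O')%N.
  by move=> O'W /orbitP[s sW <-]; apply: weyl_initial_segment.
have lo_max : lo = 0%N \/ exists2 O', O' \in weyl_orbits W &
    lo = max_index O' /\ (max_index O' < max_index O)%N.
  have [E|E] := eqVneq #|[set O' in weyl_orbits W | max_index O' < max_index O]%N| 0%N.
    left; rewrite /lo big1 // => O' HO'; move: E => /eqP; rewrite cards_eq0 => /eqP E.
    by rewrite E inE in HO'.
  right; have [|O'] := eq_bigmax_cond (@max_index n)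
      (A := mem [set O' in weyl_orbits W | max_index O' < max_index O]%N).
    by rewrite lt0n.
  by rewrite inE => /andP[O'W ltO] loE; exists O'.
exists lo; split.
- by case: lo_max => [->|[O' O'W [-> _]]]; [left | right; exists O'].
- by case: lo_max => [->//|[O' _ [-> /ltnW]]].
move=> k; have [x _ OE] := imsetP OW.
apply/idP/idP => [kO|/andP[lok kM]].
  rewrite (leq_bigmax_cond (F := fun k : 'I_n => k.+1)) // andbT.
  case: lo_max => [->//|[O' O'W [-> ltO]]]; rewrite leqNgt.
  apply/negP=> kO'; have [y yO yM] := max_mem _ OW.
  have : (y < max_index O')%N.
    rewrite (orb_lt _ k) //; move: yO kO; rewrite OE => yx /orbit_eqP ->//.
  by move: ltO; rewrite yM ltnS ltnNge => ->.
pose Ok := orbit 'P W k.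
have OkW : Ok \in weyl_orbits W by apply: imset_f.
have [y yk yM] := max_mem _ OkW; have [z zO zM] := max_mem _ OW.
have yO : (y < max_index O)%N by rewrite (orb_lt _ k).
(* An orbit of [k] ending before [O] would end by [lo], against [lo <= k]. It ends no later than [O]
   either, so the two orbits share their last element. *)
have : ~~ (max_index Ok < max_index O)%N.
  apply/negP=> lt; have : (max_index Ok <= lo)%N.
    by apply: (leq_bigmax_cond (F := @max_index n)); rewrite inE OkW.
  have : (k < max_index Ok)%N.
    by apply: (leq_bigmax_cond (F := fun k : 'I_n => k.+1)); apply: orbit_refl.
  by move=> a /(leq_trans a); rewrite ltnNge lok.
rewrite -leqNgt yM zM ltnS => zy.
have eyz : y = z by apply: val_inj; apply/eqP; rewrite eqn_leq zy -ltnS -zM yO.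
rewrite OE; apply/orbit_eqP.
have /orbit_eqP <- : z \in orbit 'P W x by rewrite -OE.
by apply/esym/orbit_eqP; rewrite -eyz.
Qed.

End WeylGroup.

(** * Flag stabilizers and the invariance of corner ranks *)

Section Flags.
Variables (F : fieldType) (n : nat).
Implicit Types (C D X Y g h : 'M[F]_n) (P : 'M[F]_n -> Prop).

Lemma mul_pid_mxE C a b i j :
  ((pid_mx b : 'M_n) *m C *m (pid_mx a : 'M_n)) i j = C i j *+ ((i < b) && (j < a))%N.
Proof.
rewrite mxE (bigD1 j) //= big1 => [|k kj]; last first.
  by rewrite [pid_mx a _ _]mxE val_eqE (negPf kj) mulr0.
rewrite [pid_mx a _ _]mxE eqxx addr0 mxE (bigD1 i) //= big1 => [|k ki]; last first.
  by rewrite mxE val_eqE eq_sym (negPf ki) mul0r.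
by rewrite mxE eqxx addr0 mulrAC -natrM mulnb mulr_natl.
Qed.

(** [(E O)^T] is a right inverse of [E O], so padding the corner with zeros keeps its rank; the
    square form can be multiplied by group elements. *)
Lemma corner_rankE C (O1 O2 : {set 'I_n}) :
  corner_rank C O1 O2
    = \rank ((pid_mx (max_index O2) : 'M_n) *m C *m (pid_mx (max_index O1) : 'M_n)).
Proof.
pose E (O : {set 'I_n}) : 'M[F]_(max_index O, n) := rowsub (widen_ord (max_index_le O)) 1%:M.
have EE O : E O *m (E O)^T = 1%:M.
  by rewrite -rowsubE; apply/matrixP=> i j; rewrite !mxE -!val_eqE /= eq_sym.
have EpidE O : (E O)^T *m E O = pid_mx (max_index O).
  apply/matrixP=> i j; rewrite !mxE; case: ltnP => [iO|Oi].
    rewrite (bigD1 (Ordinal iO)) //= big1 => [|k ki]; rewrite !mxE -!val_eqE /=.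
      by rewrite eqxx mul1r addr0 andbT.
    by rewrite -val_eqE /= in ki; rewrite (negPf ki) mul0r.
  rewrite andbF big1 // => k _; rewrite !mxE -!val_eqE /=.
  by rewrite ltn_eqF ?mul0r // (leq_trans (ltn_ord k)).
have Efree O : row_free (E O) by apply/row_freeP; exists (E O)^T.
rewrite -!EpidE mulmxA mxrankMfree // -!mulmxA -mxrank_tr trmx_mul trmxK mxrankMfree //.
rewrite mxrank_tr /corner_rank; congr (\rank _).
rewrite mulmxA -rowsubE.
have -> : (E O1)^T = colsub (widen_ord (max_index_le O1)) 1%:M.
  by apply/matrixP=> i j; rewrite !mxE eq_sym.
by rewrite -[X in mxsub _ _ X = _]mulmx1 mxsub_mul.
Qed.

Lemma sub_pid_mx p m (X : 'M[F]_(p, n)) :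
  (forall i (l : 'I_n), (m <= l)%N -> X i l = 0) -> (X <= (pid_mx m : 'M_n))%MS.
Proof.
move=> X0; apply/submxP; exists X; apply/matrixP=> i j.
rewrite mxE (bigD1 j) //= big1 => [|k kj]; last by rewrite mxE val_eqE (negPf kj) mulr0.
by rewrite mxE eqxx addr0; case: ltnP => [_|/X0->]; rewrite ?mulr1 ?mul0r.
Qed.

(** The rows of [pid_mx m] span the first [m] basis vectors, and [g^T] acting on rows is [g] acting
    on columns: this is the stabilizer of one step of the standard flag. *)
Definition stabilizes_flag m g : Prop :=
  g \in unitmx /\ ((pid_mx m : 'M_n) *m g^T <= (pid_mx m : 'M_n))%MS.

Lemma stabilizes_flagP m g : g \in unitmx ->
  (forall k l : 'I_n, (l < m <= k)%N -> g k l = 0) -> stabilizes_flag m g.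
Proof.
move=> gu g0; split=> //; apply: sub_pid_mx => i l ml.
rewrite mxE (bigD1 i) //= big1 => [|k ki].
  by rewrite !mxE eqxx addr0; case: ltnP => [im|_]; rewrite ?mul0r // g0 ?mulr0 // im.
by rewrite mxE val_eqE eq_sym (negPf ki) mul0r.
Qed.

Lemma stabilizes_flag_subgroup m : GL_subgroup (stabilizes_flag m).
Proof.
split=> [g []//||g h [gu gm] [hu hm]|g [gu gm]].
- by split; rewrite ?unitmx1 // trmx1 mulmx1.
- split; first by rewrite unitmx_mul gu.
  rewrite trmx_mul mulmxA; apply: submx_trans gm; exact: submxMr.
- split; first by rewrite unitmx_inv.
  have gTfree : row_free g^T by rewrite row_free_unit unitmx_tr.
  (* Both sides of the inclusion [gm] have the same rank, so it is an equality and can be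
     inverted. *)
  have := mxrank_leqif_eq gm; rewrite mxrankMfree // => /leqif_refl/eqmxP eqm.
  have /submxP[X pidE] : ((pid_mx m : 'M_n) <= (pid_mx m : 'M_n) *m g^T)%MS by rewrite eqm.
  rewrite {1}pidE trmx_inv -mulmxA -mulmxA mulmxV ?unitmx_tr // mulmx1.
  exact: submxMl.
Qed.

Lemma borel_stabilizes_flag m g : borel g -> stabilizes_flag m g.
Proof.
case=> gu /is_trig_mxP g_up; apply: stabilizes_flagP => // k l /andP[lm mk].
by have := g_up l k (leq_trans lm mk); rewrite mxE.
Qed.

(** The stabilizer is a subgroup, so only generators are checked: upper triangular matrices, and
    permutations preserving the initial segment. *)
Lemma parabolic_stabilizes_flag P (W : {group 'S_n}) (O : {set 'I_n}) g :
  weyl_group P W -> O \in weyl_orbits W -> P g -> stabilizes_flag (max_index O) g.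
Proof.
case=> J [J_adj PJ ->] OW /PJ; apply; first exact: stabilizes_flag_subgroup.
move=> x [/borel_stabilizes_flag//|[s sJ ->]].
apply: stabilizes_flagP => [|k l /andP[lm mk]]; first exact: unitmx_perm.
have sW : s \in <<J>>%G by apply: mem_gen.
have := weyl_initial_segment J_adj k OW sW.
by rewrite !mxE (ltnNge k) mk /=; case: (s k =P l) => // ->; rewrite lm.
Qed.

Lemma perm_mx_parabolic P (W : {group 'S_n}) s :
  standard_parabolic P -> weyl_group P W -> s \in W -> P (perm_mx s).
Proof.
case=> -[_ P1 PM _] _ [J [_ PJ ->]]; move: s.
apply: generated_ind => [|x y xJ Py]; first by rewrite perm_mx1.
rewrite perm_mxM; apply: PM => //; apply/PJ => H _; apply.
by right; exists x.
Qed.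

Lemma mx_equiv_sym (H : 'M[F]_n -> Prop) X Y :
  GL_subgroup H -> mx_equiv H X Y -> mx_equiv H Y X.
Proof.
case=> Hu _ _ HV [h [k [Hh Hk ->]]]; exists (invmx h), (invmx k); split; try exact: HV.
rewrite mulmxA mulmxK ?Hu // trmx_inv !mulmxA mulVmx ?unitmx_tr ?Hu //.
by rewrite mul1mx.
Qed.

Lemma mx_equiv_trans (H : 'M[F]_n -> Prop) X Y Z :
  GL_subgroup H -> mx_equiv H X Y -> mx_equiv H Y Z -> mx_equiv H X Z.
Proof.
case=> _ _ HM _ [h [k [Hh Hk ->]]] [h' [k' [Hh' Hk' ->]]].
exists (h *m h'), (k *m k'); split; try exact: HM.
by rewrite trmx_mul !mulmxA.
Qed.

Lemma mx_equiv_sub (H H' : 'M[F]_n -> Prop) X Y :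
  (forall g, H g -> H' g) -> mx_equiv H X Y -> mx_equiv H' X Y.
Proof. by move=> HH' [h [k [/HH' Hh /HH' Hk e]]]; exists h, k. Qed.

(** Flag stability moves [h^T] and [k] out past the projections, turning [pid h^T X k pid] into
    [A pid X pid B^T]. The rank does not grow, and symmetry gives equality. *)
Lemma corner_rank_equiv P (W : {group 'S_n}) C D (O1 O2 : {set 'I_n}) :
  standard_parabolic P -> weyl_group P W ->
  O1 \in weyl_orbits W -> O2 \in weyl_orbits W ->
  mx_equiv P C D -> corner_rank C O1 O2 = corner_rank D O1 O2.
Proof.
move=> [sP _] PW O1W O2W.
suff le X Y : mx_equiv P X Y -> (corner_rank Y O1 O2 <= corner_rank X O1 O2)%N.
  by move=> CD; apply/eqP; rewrite eqn_leq !le //; apply: mx_equiv_sym.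
case=> h [k [Ph Pk ->]]; rewrite !corner_rankE.
have [_ /submxP[A hA]] := parabolic_stabilizes_flag PW O2W Ph.
have [_ /submxP[B kB]] := parabolic_stabilizes_flag PW O1W Pk.
have {}kB : k *m (pid_mx (max_index O1) : 'M_n) = (pid_mx (max_index O1) : 'M_n) *m B^T.
  by apply: trmx_inj; rewrite !trmx_mul trmxK tr_pid_mx.
rewrite -!mulmxA kB !mulmxA hA; apply: leq_trans (mxrankM_maxl _ _) _.
by rewrite -!mulmxA mxrankM_maxr.
Qed.

Lemma rank_partial_perm q (s t : 'I_q -> 'I_n) : injective s -> injective t ->
  \rank ((rowsub s (1%:M : 'M[F]_n))^T *m rowsub t 1%:M) = q.
Proof.
have free (u : 'I_q -> 'I_n) : injective u -> row_free (rowsub u (1%:M : 'M[F]_n)).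
  move=> u_inj; apply/row_freeP; exists (rowsub u 1%:M)^T; rewrite -rowsubE.
  by apply/matrixP=> i j; rewrite !mxE (inj_eq u_inj) eq_sym.
move=> /free/eqP s_rk /free t_free.
by rewrite mxrankMfree // mxrank_tr.
Qed.

(** The padded corner has an entry 1 at [(c.2 k, k)] for each [k] in [A] and 0 elsewhere, hence is a
    product of two partial permutation matrices of rank [#|A|]. *)
Lemma corner_rank_couple Y c (O1 O2 : {set 'I_n}) : couple Y c ->
  corner_rank Y O1 O2
    = #|[set k | [&& c.1 k, (k < max_index O1)%N & (c.2 k < max_index O2)%N]]|.
Proof.
move=> /coupleP Yc; rewrite corner_rankE; set A := [set k | _].
rewrite -[RHS](@rank_partial_perm #|A| (c.2 \o enum_val) enum_val); last exact: enum_val_inj.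
  congr (\rank _); apply/matrixP=> i j; rewrite mul_pid_mxE Yc !mxE.
  rewrite -mulrnA mulnb; have [jA|jA] := boolP (j \in A).
    rewrite (bigD1 (enum_rank_in jA j)) //= big1 => [|k kj]; last first.
      rewrite !mxE; case: (enum_val k =P j) => [e|]; rewrite ?mulr0 //.
      by case/eqP: kj; apply: enum_val_inj; rewrite enum_rankK_in.
    rewrite !mxE /= enum_rankK_in // eqxx mulr1 addr0 eq_sym.
    move: jA; rewrite inE => /and3P[-> jM sM] /=.
    by case: eqP => // <-; rewrite jM sM.
  rewrite big1 => [|k _].
    rewrite (_ : _ && _ = false) //; apply: contraNF jA.
    by rewrite inE -andbA => /and3P[-> /eqP <- /andP[-> ->]].
  rewrite !mxE; case: (enum_val k =P j) => [e|]; rewrite ?mulr0 //.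
  by rewrite -e enum_valP in jA.
exact: inj_comp perm_inj enum_val_inj.
Qed.

End Flags.

(** * From corner counts to orbit counts, and from these to [W]-equivalence *)

Section Counting.
Variables (n : nat) (J : {set 'S_n}).
Hypothesis J_adj : J \subset adjacent_transpositions n.
Let W : {group 'S_n} := <<J>>%G.
Implicit Types (c d : {ffun 'I_n -> bool} * 'S_n) (O : {set 'I_n}).

Lemma mem_weyl_orbits O x : O \in weyl_orbits W -> (x \in O) = (orbit 'P W x == O).
Proof.
case/imsetP=> y _ ->.
by apply/orbit_eqP/eqP.
Qed.

Lemma couple_count_of_corners c d :
  (forall O1 O2, O1 \in weyl_orbits W -> O2 \in weyl_orbits W ->
     #|[set k | [&& c.1 k, (k < max_index O1)%N & (c.2 k < max_index O2)%N]]|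
   = #|[set k | [&& d.1 k, (k < max_index O1)%N & (d.2 k < max_index O2)%N]]|) ->
  forall O1 O2, O1 \in weyl_orbits W -> O2 \in weyl_orbits W ->
    couple_count O1 O2 c = couple_count O1 O2 d.
Proof.
pose N c a b := #|[set k | [&& c.1 k, (k < a)%N & (c.2 k < b)%N]]|.
move=> eqN O1 O2 O1W O2W.
have [lo1 [lo1P le1 O1E]] := weyl_orbit_interval J_adj O1W.
have [lo2 [lo2P le2 O2E]] := weyl_orbit_interval J_adj O2W.
(* The equality extends to the bound 0, where both counts vanish. *)
have {}eqN a b : a = 0%N \/ (exists2 O, O \in weyl_orbits W & a = max_index O) ->
    b = 0%N \/ (exists2 O, O \in weyl_orbits W & b = max_index O) -> N c a b = N d a b.
  case=> [->|[O OW ->]] [->|[O' O'W ->]]; try exact: eqN;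
    by apply: eq_card => k; rewrite !inE ltn0 ?andbF.
have card_sum (p : pred 'I_n) : #|[set k | p k]| = (\sum_k p k)%N.
  by rewrite cardsE -sum1_card big_mkcond.
(* Inclusion-exclusion without subtraction, checked index by index on indicators. *)
have countE e : (couple_count O1 O2 e + N e lo1 (max_index O2) + N e (max_index O1) lo2
    = N e (max_index O1) (max_index O2) + N e lo1 lo2)%N.
  rewrite /N /couple_count !card_sum -!big_split /=; apply: eq_bigr => k _.
  by rewrite O1E O2E; case: (e.1 k) => //=; lia.
have := countE c; rewrite !eqN; try by [left | right; exists O1 | right; exists O2 |].
by move: (countE d); lia.
Qed.

Lemma weyl_equiv_of_couple_count (F : fieldType) (Y Z : 'M[F]_n) c d :
  couple Y c -> couple Z d ->
  (forall O1 O2, O1 \in weyl_orbits W -> O2 \in weyl_orbits W ->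
     couple_count O1 O2 c = couple_count O1 O2 d) ->
  mx_equiv (@perm_mxs F n W) Y Z.
Proof.
move=> /coupleP Yc /coupleP Zd eq_cd.
pose o x := orbit 'P W x.
(* The orbit of the image of [e_k], or [None] when the image is 0. *)
pose target (e : {ffun 'I_n -> bool} * 'S_n) k := if e.1 k then Some (o (e.2 k)) else None.
have oW x : o x \in weyl_orbits W by apply: imset_f.
have [l1 l2|a aP] := @perm_of_partial_fibres n _ _ o (target c) (target d).
  have fibreE e : #|[set k | (o k == l1) && (target e k == Some l2)]| =
      if (l1 \in weyl_orbits W) && (l2 \in weyl_orbits W) then couple_count l1 l2 e else 0%N.
    have [/andP[l1W l2W]|lW] := boolP (_ && _).
      apply: eq_card => k; rewrite !inE !mem_weyl_orbits // /target.
      by case: (e.1 k); rewrite //= andbF.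
    apply: eq_card0 => k; rewrite inE; apply: contraNF lW.
    by rewrite /target; case: (e.1 k) => /= /andP[/eqP <-] // /eqP[<-]; rewrite !oW.
  by rewrite !fibreE; case: andP => // -[]; apply: eq_cd.
(* The column sent to row [j] by [s]. The support of [c] serves for both couples because [a] matches
   the supports. *)
pose source (s : 'S_n) j := if c.1 (s^-1 j)%g then Some (s^-1 j)%g else None.
have o_tgt k : c.1 k -> o (c.2 k) = o ((a * d.2)%g k).
  by move=> ck; have [_] := aP k; rewrite /target ck permM; case: (d.1 _) => // -[->].
have [l k|b bP] := @perm_of_partial_fibres n _ _ o (source c.2) (source (a * d.2)%g).
  (* A fibre is [[set s k]] or empty, so it suffices that [c.2 k] and [d.2 (a k)] lie in one orbit,
     which is [o_tgt]. *)
  have fibreE (s : 'S_n) : #|[set j | (o j == l) && (source s j == Some k)]|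
      = (c.1 k && (o (s k) == l))%N.
    have -> : [set j | (o j == l) && (source s j == Some k)]
        = if c.1 k && (o (s k) == l) then [set s k] else set0.
      apply/setP=> j; rewrite inE /source.
      have -> : (j \in if c.1 k && (o (s k) == l) then [set s k] else set0)
          = [&& c.1 k, o (s k) == l & (s^-1)%g j == k].
        rewrite (canF_eq (permKV s)).
        by case: (c.1 k); case: (o (s k) == l); rewrite inE.
      have [<-|ne] := eqVneq ((s^-1)%g j) k; last first.
        rewrite !andbF; case: (c.1 _); rewrite ?andbF //.
        by rewrite (inj_eq Some_inj) (negPf ne) andbF.
      by rewrite permKV andbT andbC; case: (c.1 _); rewrite ?eqxx.
    by case: ifP; rewrite ?cards1 ?cards0.
  by rewrite !fibreE; case ck : (c.1 k); rewrite //= o_tgt.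
have bE k : c.1 k -> b (c.2 k) = d.2 (a k).
  move=> ck; have [_] := bP (c.2 k).
  rewrite /source permK ck; case: (c.1 _) => // -[/(canRL (permKV _))].
  by rewrite permM.
have aE k : d.1 (a k) = c.1 k.
  by have [_] := aP k; rewrite /target; do 2!case: ifP.
(* As [perm_mx a] sends [e_(a k)] to [e_k] and [(perm_mx b)^T] sends [e_j] to [e_(b j)], the product
   sends [e_(a k)] to [e_(b (c.2 k))] on the support, as [Z] does by [bE]. *)
exists (perm_mx b), (perm_mx a); split.
- by exists b => //; apply: mem_weyl_orbit => // x; have [] := bP x.
- by exists a => //; apply: mem_weyl_orbit => // x; have [] := aP x.
rewrite tr_perm_mx -row_permE -[a]invgK -col_permE; apply/matrixP=> i j.
rewrite !mxE Yc Zd -{1 2}(permKV a j) -{1}(permKV b i) aE.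
case ck: (c.1 _) => //=; rewrite -bE // (inj_eq perm_inj).
by rewrite ?invgK.
Qed.

End Counting.

(** * Assembling the cycle of implications *)

Theorem theorem5p1 (F : fieldType) (n : nat) (n_ge2 : (2 <= n)%N)
    (P : 'M[F]_n -> Prop) (P_parabolic : standard_parabolic P)
    (W : {group 'S_n}) (W_weyl : weyl_group P W)
    (C D Y Z : 'M[F]_n)
    (Y01 : zero_one_mx Y) (Y_sub : sub_permutation Y)
    (Z01 : zero_one_mx Z) (Z_sub : sub_permutation Z)
    (YC : mx_equiv (@borel F n) Y C) (ZD : mx_equiv (@borel F n) Z D) :
  [<-> mx_equiv P C D;
       forall Oi Oj : {set 'I_n}, Oi \in weyl_orbits W -> Oj \in weyl_orbits W ->
         corner_rank C Oi Oj = corner_rank D Oi Oj;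
       mx_equiv (@perm_mxs F n W) Y Z;
       forall Oi Oj : {set 'I_n}, Oi \in weyl_orbits W -> Oj \in weyl_orbits W ->
         transfer_count Y Oi Oj = transfer_count Z Oi Oj].
Proof.
have [sP BP] := P_parabolic.
have [J [J_adj _ WJ]] := W_weyl.
have [c Yc] := couple_exists Y01 Y_sub; have [d Zd] := couple_exists Z01 Z_sub.
have YC_P := mx_equiv_sub BP YC; have ZD_P := mx_equiv_sub BP ZD.
have rank_equiv X X' (XX' : mx_equiv P X X') O1 O2 (O1W : O1 \in weyl_orbits W)
    (O2W : O2 \in weyl_orbits W) : corner_rank X O1 O2 = corner_rank X' O1 O2.
  exact: corner_rank_equiv P_parabolic W_weyl O1W O2W XX'.
have weyl_parabolic : mx_equiv (@perm_mxs F n W) Y Z -> mx_equiv P C D.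
  move=> YZ; apply: mx_equiv_trans ZD_P => //.
  apply: mx_equiv_trans (mx_equiv_sym sP YC_P) _ => //.
  apply: mx_equiv_sub YZ => _ [s sW ->]; exact: perm_mx_parabolic W_weyl sW.
have rank_count : (forall O1 O2, O1 \in weyl_orbits W -> O2 \in weyl_orbits W ->
      corner_rank C O1 O2 = corner_rank D O1 O2) ->
    forall O1 O2, O1 \in weyl_orbits W -> O2 \in weyl_orbits W ->
      transfer_count Y O1 O2 = transfer_count Z O1 O2.
  move=> eqCD O1 O2; rewrite (transfer_countE _ _ Yc) (transfer_countE _ _ Zd).
  move: O1 O2; rewrite WJ; apply: couple_count_of_corners => // O1 O2.
  rewrite -WJ => O1W O2W; rewrite -(corner_rank_couple _ _ Yc) -(corner_rank_couple _ _ Zd).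
  by rewrite (rank_equiv _ _ YC_P) // (rank_equiv _ _ ZD_P) // eqCD.
have count_weyl : (forall O1 O2, O1 \in weyl_orbits W -> O2 \in weyl_orbits W ->
      transfer_count Y O1 O2 = transfer_count Z O1 O2) -> mx_equiv (@perm_mxs F n W) Y Z.
  rewrite WJ => eqYZ; apply: (weyl_equiv_of_couple_count J_adj Yc Zd) => O1 O2 O1W O2W.
  by rewrite -(transfer_countE _ _ Yc) -(transfer_countE _ _ Zd) eqYZ.
(* The listed order differs from the proved cycle: (b) gives (c) through (d), (c) gives (d) through
   (a) and (b), and (d) gives (a) through (c). *)
tfae=> [CD O1 O2|/rank_count/count_weyl //|/weyl_parabolic CD|/count_weyl/weyl_parabolic //].
  exact: rank_equiv.
by apply: rank_count => O1 O2; apply: rank_equiv.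
Qed.
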